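(* Let $\delta>0$ and $\gamma\ge 0$, let $G(t)$, $t\ge 0$, be the inverse Gaussian subordinator with parameters $\delta$ and $\gamma$, and let $H(t)=\inf\{s\ge 0: G(s)>t\}$ be its first-passage time process. Then for every $t>0$ the distribution of $H(t)$ is not infinitely divisible.
   Context: A subordinator is a one-dimensional Lévy process started at $0$ with almost surely non-decreasing sample paths. The inverse Gaussian subordinator with parameters $\delta,\gamma$ is the subordinator with $\mathbb{E}(e^{-uG(t)})=e^{-t\delta(\sqrt{2u+\gamma^2}-\gamma)}$ for $u>0$, $t\ge 0$; equivalently, for $t>0$, $G(t)$ has density $\frac{\delta t}{\sqrt{2\pi}}e^{\delta\gamma t}y^{-3/2}e^{-\frac12\left(\frac{\delta^2t^2}{y}+\gamma^2y\right)}$, $y>0$. A real random variable $X$ (or its distribution) is infinitely divisible if for each $n>1$ there exist i.i.d. random variables $X_1,\dots,X_n$ (with law depending on $n$) such that $X$ and $X_1+\cdots+X_n$ have the same distribution. *)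

(* Defs.v *)
From HB Require Import structures.
From mathcomp Require Import all_boot all_order all_algebra.
From mathcomp Require Import all_classical all_reals all_analysis.
From mathcomp Require Import measurable_realfun.

Set Implicit Arguments.
Unset Strict Implicit.
Unset Printing Implicit Defensive.

Import Order.TTheory GRing.Theory Num.Theory.
Import numFieldNormedType.Exports.

Local Open Scope classical_set_scope.
Local Open Scope ring_scope.

(* Two real random variables, possibly living on different probability spaces.
   [pushforward P X] is what [distribution P X] unfolds to, for an unbundled X. *)
Definition same_distribution (d d' : measure_display) (T : measurableType d)
    (T' : measurableType d') (R : realType) (P : probability T R)
    (P' : probability T' R) (X : T -> R) (Y : T' -> R) : Prop :=
  forall B : set R, measurable B -> pushforward P X B = pushforward P' Y B.

(* Mutual independence. Taking [B i := setT] for some of the indices gives the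
   product rule for every subfamily. *)
Definition independent_RVs (d : measure_display) (T : measurableType d)
    (R : realType) (P : probability T R) (n : nat) (X : 'I_n -> T -> R) : Prop :=
  forall B : 'I_n -> set R, (forall i, measurable (B i)) ->
    P (\bigcap_(i in [set: 'I_n]) (X i @^-1` B i)) =
    (\prod_(i < n) P (X i @^-1` B i))%E.

Definition iid_RVs (d : measure_display) (T : measurableType d)
    (R : realType) (P : probability T R) (n : nat) (X : 'I_n -> T -> R) : Prop :=
  independent_RVs P X /\ forall i j, same_distribution P P (X i) (X j).

(* The probability space carrying X_1, ..., X_n may depend on n and need not be
   the one on which X is defined. *)
Definition infinitely_divisible (d : measure_display) (T : measurableType d)
    (R : realType) (P : probability T R) (X : {RV P >-> R}) : Prop :=
  forall n : nat, (1 < n)%N ->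
    exists (d' : measure_display) (T' : measurableType d')
           (P' : probability T' R) (Xn : 'I_n -> {RV P' >-> R}),
      iid_RVs P' Xn /\
      same_distribution P P' X (fun w => \sum_(i < n) Xn i w).

(* A process indexed by [0, +oo[ is a function on R; its values at negative
   times are never used. *)
Section processes.
Context (d : measure_display) (T : measurableType d) (R : realType)
        (P : probability T R).
Implicit Types G : R -> {RV P >-> R}.

Definition independent_increments G : Prop :=
  forall (n : nat) (s : nat -> R), 0 <= s 0%N ->
    (forall i, (i < n)%N -> s i <= s i.+1) ->
    independent_RVs P (fun (i : 'I_n) w => G (s i.+1) w - G (s i) w).

Definition stationary_increments G : Prop :=
  forall s t : R, 0 <= s -> 0 <= t ->
    same_distribution P P (fun w => G (s + t) w - G s w)
                          (fun w => G t w - G 0 w).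

Definition stochastically_continuous G : Prop :=
  forall t e : R, 0 <= t -> 0 < e ->
    P [set w | e <= `|G s w - G t w|] @[s --> within [set s | 0 <= s] (nbhs t)]
      --> (0 : \bar R).

(* No path regularity is imposed: a process satisfying these axioms has a
   modification with right-continuous paths with left limits, and requiring the
   latter of G itself gives a special case. *)
Record levy_process G : Prop := {
  levy_start0 : {ae P, forall w, G 0 w = 0} ;
  levy_independent : independent_increments G ;
  levy_stationary : stationary_increments G ;
  levy_continuous : stochastically_continuous G }.

Definition subordinator G : Prop :=
  levy_process G /\
  {ae P, forall w, forall s t : R, 0 <= s -> s <= t -> G s w <= G t w}.

Definition inverse_gaussian_subordinator (delta gamma : R) G : Prop :=
  subordinator G /\
  forall u t : R, 0 < u -> 0 <= t ->
    'E_P[fun w => expR (- (u * G t w))]%E =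
    (expR (- (t * delta * (Num.sqrt (2 * u + gamma ^+ 2) - gamma))))%:E.

(* Extended-real infimum, so that inf of the empty set is +oo. *)
Definition first_passage_time G (t : R) (w : T) : \bar R :=
  ereal_inf [set s%:E | s in [set s : R | 0 <= s /\ t < G s w]].

(* The paths of G are only almost surely monotone, so the pathwise infimum need
   be finite and measurable only up to a null set. H(t) is therefore any real
   random variable almost surely equal to it; all of them have the same law,
   and one always exists, see [first_passage_RV_exists] below. *)
Definition is_first_passage_RV G (t : R) (H : {RV P >-> R}) : Prop :=
  {ae P, forall w, (H w)%:E = first_passage_time G t w}.

End processes.

Section first_passage_existence.
Context (d : measure_display) (T : measurableType d) (R : realType)
        (P : probability T R).
Implicit Types G : R -> {RV P >-> R}.

Let mRV (X : {RV P >-> R}) : measurable_fun [set: T] (X : T -> R).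
Proof. exact: measurable_funPT. Qed.

Let pack_RV (f : T -> R) : measurable_fun [set: T] f ->
  exists X : {RV P >-> R}, f = X.
Proof.
move=> mf.
pose X : {mfun T >-> R} := HB.pack f (@isMeasurableFun.Build _ _ T R f mf).
by exists X.
Qed.

Let inverse_gaussian_unbounded (delta gamma : R) G (t : R) :
  0 < delta -> 0 <= gamma -> inverse_gaussian_subordinator delta gamma G ->
  {ae P, forall w, exists n : nat, t < G n%:R w}.
Proof.
move=> d0 g0 [_ lapl].
set c := Num.sqrt (2 * 1 + gamma ^+ 2) - gamma.
have c0 : 0 < c.
  rewrite subr_gt0 -[X in X < _](ger0_norm g0) -sqrtr_sqr ltr_sqrt; last first.
    by rewrite ltr_wpDr ?sqr_ge0// mulr1 ltr0n.
  by rewrite ltrDr mulr1 ltr0n.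
pose A n := [set w | G n%:R w <= t].
have mA n : measurable (A n).
  rewrite (_ : A n = setT `&` [set w | G n%:R w <= t]); last by rewrite setTI.
  apply: (measurable_fun_le measurableT) => //; exact: mRV.
exists (\bigcap_n A n); split.
- exact: bigcapT_measurable.
- have dc0 : 0 < delta * c by exact: mulr_gt0.
  have bnd n : (P (A n) <= (expR (- (n%:R * (delta * c))) * expR t)%:E)%E.
    have [X hX] : exists X : {RV P >-> R}, (fun w => - G n%:R w) = X.
      by apply: pack_RV; exact: measurableT_comp (mRV _).
    have := @chernoff _ _ _ P X 1 (- t) ltr01.
    rewrite /mmt_gen_fun -hX.
    rewrite (_ : expR \o 1 \o* _ = fun w => expR (- (1 * G n%:R w))); last first.
      by apply/funext => w /=; rewrite mulr1 mul1r.
    rewrite lapl// -EFinM mul1r opprK mulrA => h.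
    apply: le_trans h; rewrite le_eqVlt; apply/orP; left; apply/eqP.
    by congr (P _); apply/seteqP; split => w; rewrite /A /= lerN2.
  apply/eqP; rewrite eq_le measure_ge0 andbT; apply/lee_addgt0Pr => e e0.
  rewrite add0e.
  have cv : expR (- (n%:R * (delta * c))) * expR t @[n --> \oo] --> (0 : R).
    rewrite -[X in _ --> X](mul0r (expR t)); apply: cvgMr_tmp.
    have cM : (x * (delta * c)) @[x --> +oo] --> +oo.
      exact: gt0_cvgMly dc0 cvg_id.
    have cn := cvg_comp _ _ (@cvgr_idn R) cM.
    exact: (cvg_comp _ _ cn (@cvgr_expR R)).
  have [n _ /(_ n (leqnn n)) hn] : \forall n \near \oo,
      expR (- (n%:R * (delta * c))) * expR t <= e.
    exact: (cvgr_le _ cv).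
  apply: le_trans (le_measure P _ _ _) (le_trans (bnd n) _) => //;
    rewrite ?inE//; first exact: bigcapT_measurable.
  exact: bigcap_inf.
- move=> w /= nw n _; rewrite /A /= leNgt; apply/negP => tG.
  by apply: nw; exists n.
Qed.

Lemma first_passage_RV_exists (delta gamma : R) G (t : R) :
  0 < delta -> 0 <= gamma -> inverse_gaussian_subordinator delta gamma G ->
  exists H : {RV P >-> R}, is_first_passage_RV G t H.
Proof.
move=> d0 g0 IG; have unb := inverse_gaussian_unbounded t d0 g0 IG.
case: IG => -[_ mono] _.
pose r (n : nat) : R := `|ratr (odflt 0 (unpickle n : option rat))|.
pose f (n : nat) (w : T) : \bar R := (if (t < G (r n) w)%R then (r n)%:E else +oo)%E.
have mf n : measurable_fun setT (f n).
  apply: measurable_fun_ifT => //.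
  by apply: measurable_fun_ltr => //; exact: mRV.
pose K w := einfs (f ^~ w) 0%N.
have mK : measurable_fun setT K by exact: measurable_fun_einfs.
have [H HE] : exists H : {RV P >-> R}, (fun w => fine (K w)) = H.
  apply: pack_RV; apply: (measurableT_comp _ mK); exact: fine_measurable.
exists H; apply: filterS2 mono unb => w mon [m tm].
have KE : K w = first_passage_time G t w.
  apply/eqP; rewrite eq_le; apply/andP; split.
  - apply: le_ereal_inf_tmp => _ [s [s0 ts] <-].
    apply/lee_addgt0Pr => e e0; rewrite -EFinD.
    have [q] := @rat_in_itvoo R s (s + e) ltac:(by rewrite ltrDl).
    rewrite in_itv /= => /andP[sq qe].
    have rE : r (pickle q) = ratr q.
      by rewrite /r pickleK /= ger0_norm// (le_trans s0)// ltW.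
    apply: (@le_trans _ _ (f (pickle q) w)).
      by apply: ereal_inf_lbound; exists (pickle q).
    rewrite /f rE (lt_le_trans ts) ?mon ?(ltW sq)//.
    by rewrite lee_fin ltW.
  - apply: le_ereal_inf_tmp => _ [n _ <-]; rewrite /f.
    case: ifPn => [trn|_]; last exact: leey.
    by apply: ereal_inf_lbound; exists (r n) => //; split=> //; exact: normr_ge0.
rewrite -HE -KE /= fineK//.
rewrite KE fin_numElt; apply/andP; split.
- apply: (@lt_le_trans _ _ 0%E) => //.
  by apply: le_ereal_inf_tmp => _ [s [s0 _] <-]; rewrite lee_fin.
- apply: (@le_lt_trans _ _ (m%:R)%:E) (ltry _).
  by apply: ereal_inf_lbound; exists m%:R.
Qed.

End first_passage_existence.

(* Main.v *)
(* G(x) has a light lower tail: P(H(t) > x) <= P(G(x) <= t) is at most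
   exp(u t - x delta (sqrt(2 u + gamma^2) - gamma)) for all u > 0. If H(t) is a
   sum of n i.i.d. variables X_i, these are nonnegative and P(X_i > eps)^n is at
   most P(H(t) > n eps); taking u = n gives P(X_i > eps) = O(exp(- c sqrt n)),
   hence n P(X_i > eps) tends to 0. Up to a small probability H(t) is thus a sum
   of independent variables with values in [0, eps], whose variance is at most
   eps times its mean, and Chebyshev's inequality as eps tends to 0 shows that
   H(t) is bounded. But then G(s) > t almost surely for some s, so that
   s delta (sqrt(2 u + gamma^2) - gamma) >= u t for all u > 0, which fails for
   large u. *)
Require Import Defs.
From HB Require Import structures.
From mathcomp Require Import all_boot all_order all_algebra.
From mathcomp Require Import all_classical all_reals all_analysis.
From mathcomp Require Import measurable_realfun ring lra.

Set Implicit Arguments.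
Unset Strict Implicit.

Import Order.TTheory GRing.Theory Num.Theory.
Import numFieldNormedType.Exports.

Local Open Scope classical_set_scope.
Local Open Scope ring_scope.

(** * Moments of bounded and of independent random variables *)

Lemma measurable_RV (d : measure_display) (T : measurableType d) (R : realType)
    (P : probability T R) (f : T -> R) :
  measurable_fun [set: T] f -> exists X : {RV P >-> R}, f = X.
Proof.
move=> mf.
pose X : {mfun T >-> R} := HB.pack f (@isMeasurableFun.Build _ _ T R f mf).
by exists X.
Qed.

Lemma bounded_Lfun2 (d : measure_display) (T : measurableType d) (R : realType)
    (P : probability T R) (X : T -> R) (M : R) :
  measurable_fun [set: T] X -> (forall w, `|X w| <= M) -> X \in Lfun P 2%:E.
Proof.
move=> mX XM; apply/andP; split; rewrite inE //=.
rewrite /finite_norm unlock /Lnorm poweR_lty//.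
apply: (@le_lt_trans _ _ (\int[P]_x (M `^ 2)%:E)%E).
  apply: ge0_le_integral => //=.
  - apply/measurable_EFinP.
    apply: (@measurableT_comp _ _ _ _ _ _ (@powR R ^~ 2)) => //.
    exact: measurableT_comp.
  - move=> x _; rewrite lee_fin ge0_ler_powR// ?nnegrE//.
    exact: le_trans (XM x).
by rewrite integral_cst//= probability_setT mule1 ltry.
Qed.

Definition independent_pair (d : measure_display) (T : measurableType d)
    (R : realType) (P : probability T R) (X Y : T -> R) : Prop :=
  forall A B : set R, measurable A -> measurable B ->
    P (X @^-1` A `&` Y @^-1` B) = (P (X @^-1` A) * P (Y @^-1` B))%E.

(* The joint law is the product of the marginals, so Tonelli applies. *)
Lemma expectation_mul_indep (d : measure_display) (T : measurableType d)
    (R : realType) (P : probability T R) (X Y : {RV P >-> R}) :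
  (forall w, 0 <= X w) -> (forall w, 0 <= Y w) -> independent_pair P X Y ->
  ('E_P[X * Y] = 'E_P[X] * 'E_P[Y])%E.
Proof.
move=> X0 Y0 XY.
have mX : measurable_fun setT X by exact: measurable_funPT.
have mY : measurable_fun setT Y by exact: measurable_funPT.
have mZ : measurable_fun setT (fun w => (X w, Y w)) by exact: measurable_fun_pair.
pose Z : {mfun T >-> (R * R)%type} := HB.pack (fun w => (X w, Y w))
  (@isMeasurableFun.Build _ _ _ _ _ mZ).
pose PX := distribution P X; pose PY := distribution P Y.
(* The absolute values make the integrand nonnegative on the whole plane, as Tonelli requires; on
   the range of [Z] it is the plain product. *)
pose f (z : R * R) : \bar R := (`|z.1| * `|z.2|)%:E.
have mf : measurable_fun setT f.
  apply/measurable_EFinP; apply: measurable_funM.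
    exact: measurableT_comp measurable_fst.
  exact: measurableT_comp measurable_snd.
have f0 z : (0 <= f z)%E by rewrite lee_fin mulr_ge0.
have -> : ('E_P[X * Y] = \int[distribution P Z]_z f z)%E.
  rewrite ge0_integral_distribution// unlock; apply: eq_integral => w _ /=.
  by rewrite /f /= !ger0_norm.
have -> : (\int[distribution P Z]_z f z = \int[PX \x PY]_z f z)%E.
  apply: eq_measure_integral => A mA _; apply/esym.
  (* Independence says that the joint law and the product measure agree on measurable rectangles,
     which determines the law. *)
  by apply: product_measure_unique => // B C mB mC; exact: XY.
rewrite fubini_tonelli1// /fubini_F.
have nn (V : {RV P >-> R}) : (forall w, 0 <= V w) ->
    (\int[distribution P V]_y (`|y|)%:E = 'E_P[V])%E.
  move=> V0; rewrite ge0_integral_distribution//; last first.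
    by apply/measurable_EFinP; exact: normr_measurable.
  by rewrite unlock; apply: eq_integral => w _ /=; rewrite ger0_norm.
transitivity (\int[PX]_x (`|x|%:E * 'E_P[Y]))%E.
  apply: eq_integral => x _; rewrite -nn// -ge0_integralZl//=.
  by apply/measurable_EFinP; exact: normr_measurable.
rewrite ge0_integralZr//= ?nn//; last exact: expectation_ge0.
by apply/measurable_EFinP; exact: normr_measurable.
Qed.

(** Expand E[S^2] and (E S)^2 as double sums. By independence the off-diagonal terms agree and
    cancel; on the diagonal, Y_i^2 <= eps Y_i. *)
Lemma variance_sum_le (d : measure_display) (T : measurableType d)
    (R : realType) (P : probability T R) (n : nat) (Y : 'I_n -> {RV P >-> R})
    (S : {RV P >-> R}) (eps : R) :
  (forall i w, 0 <= Y i w <= eps) ->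
  (forall i j, i != j -> independent_pair P (Y i) (Y j)) ->
  (forall w, S w = \sum_(i < n) Y i w) ->
  ('V_P[S] <= eps%:E * 'E_P[S])%E.
Proof.
move=> Y0 indep SE.
have Y_ge0 i w : 0 <= Y i w by have /andP[] := Y0 i w.
have mY i : measurable_fun setT (Y i) by exact: measurable_funPT.
have YL2 i : (Y i : T -> R) \in Lfun P 2%:E.
  apply: (@bounded_Lfun2 _ _ _ _ _ eps) => // w.
  by rewrite ger0_norm//; have /andP[] := Y0 i w.
have SL2 : (S : T -> R) \in Lfun P 2%:E.
  apply: (@bounded_Lfun2 _ _ _ _ _ (\sum_(i < n) eps)); first exact: measurable_funPT.
  move=> w; rewrite SE ger0_norm ?sumr_ge0//.
  by apply: ler_sum => i _; have /andP[] := Y0 i w.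
have Efin (X : T -> R) : X \in Lfun P 2%:E -> ('E_P[X])%E \is a fin_num.
  by move=> XL2; apply: expectation_fin_num; rewrite Lfun_subset12 ?fin_num_measure.
have ES : ('E_P[S] = \sum_(i < n) 'E_P[Y i])%E.
  rewrite unlock -ge0_integral_sum//; last 2 first.
  - by move=> i; exact/measurable_EFinP.
  - by move=> i w _; rewrite lee_fin.
  by apply: eq_integral => w _; rewrite SE sumEFin.
have ES2 : ('E_P[(S : T -> R) ^+ 2] = \sum_(i < n) \sum_(j < n) 'E_P[(Y i : T -> R) * Y j])%E.
  rewrite unlock pair_big /= -ge0_integral_sum//; last 2 first.
  - by move=> i; apply/measurable_EFinP; exact: measurable_funM.
  - by move=> i w _; rewrite lee_fin mulr_ge0.
  apply: eq_integral => w _; rewrite sumEFin.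
  change ((S w ^+ 2)%:E = (\sum_(p : 'I_n * 'I_n) (Y p.1 w * Y p.2 w))%:E).
  by rewrite SE expr2 big_distrlr /= pair_big.
have EY2 i : ('E_P[(Y i : T -> R) * Y i] <= eps%:E * 'E_P[Y i])%E.
  rewrite -expectationZl ?Lfun_subset12 ?fin_num_measure//.
  apply: expectation_le => //=.
  - by move=> w; exact: mulr_ge0.
  - move=> w; rewrite mulr_ge0//.
    by have /andP[a b] := Y0 i w; exact: le_trans b.
  - apply/aeW => w; rewrite [leRHS]mulrC.
    by rewrite ler_wpM2r//; have /andP[] := Y0 i w.
rewrite varianceE// leeBlDr; last by rewrite fin_numX// Efin.
rewrite ES2 expe2 {2}ES ge0_sume_distrl; last by move=> i _; exact: expectation_ge0.
rewrite ES ge0_sume_distrr; last by move=> i _; exact: expectation_ge0.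
rewrite -big_split /=; apply: lee_sum => i _.
rewrite -ES [in leRHS]ES ge0_sume_distrr; last by move=> j _; exact: expectation_ge0.
rewrite (bigD1 i)//= [in leRHS](bigD1 i)//= addeA.
(* Row [i]: the diagonal term is at most eps E[Y_i], and the nonnegative E[Y_i]^2 on the right is
   dropped; the remaining terms are equal. *)
apply: leeD.
  apply: (le_trans (EY2 i)); apply: leeDl.
  by rewrite mule_ge0// expectation_ge0.
rewrite le_eqVlt; apply/orP; left; apply/eqP; apply: eq_bigr => j ji.
by rewrite expectation_mul_indep//; apply: indep; rewrite eq_sym.
Qed.

(** Use the product rule with the whole line at every index other than [i] and [j], so that the
    other factors are 1. The map [f] will be a truncation. *)
Lemma independent_RVs_pair (d : measure_display) (T : measurableType d)
    (R : realType) (P : probability T R) (n : nat) (X : 'I_n -> T -> R)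
    (f : R -> R) (i j : 'I_n) :
  measurable_fun setT f -> independent_RVs P X -> i != j ->
  independent_pair P (f \o X i) (f \o X j).
Proof.
move=> mf indep ij A B mA mB.
have mfpre C : measurable C -> measurable (f @^-1` C).
  by move=> mC; rewrite -[X in measurable X]setTI; exact: mf.
pose C k := if k == i then f @^-1` A else if k == j then f @^-1` B else setT.
have Ci : C i = f @^-1` A by rewrite /C eqxx.
have Cj : C j = f @^-1` B by rewrite /C eq_sym (negbTE ij) eqxx.
have CT k : k != i -> k != j -> C k = setT.
  by move=> /negbTE ki /negbTE kj; rewrite /C ki kj.
have := indep C; rewrite (bigD1 i)//= (bigD1 j) 1?eq_sym//= Ci Cj.
rewrite big1 ?mule1; last first.
  by move=> k /andP[ki kj]; rewrite CT// preimage_setT probability_setT.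
move=> <-; last first.
  by move=> k; rewrite /C; case: ifP => _; [exact: mfpre|case: ifP => _//; exact: mfpre].
congr (P _); apply/seteqP; split => w /=.
- move=> [Aw Bw] k _ /=.
  have [->|ki] := eqVneq k i; first by rewrite Ci.
  have [->|kj] := eqVneq k j; first by rewrite Cj.
  by rewrite CT.
- by move=> h; split; [have := h i I; rewrite Ci|have := h j I; rewrite Cj].
Qed.

(** * Union bounds, and the tail of a sum of small independent variables *)

Lemma measurable_set_le (d : measure_display) (T : measurableType d)
    (R : realType) (f g : T -> R) :
  measurable_fun setT f -> measurable_fun setT g ->
  measurable [set w | f w <= g w].
Proof.
move=> mf mg; rewrite -[X in measurable X]setTI.
exact: (measurable_fun_le measurableT).
Qed.

Lemma measurable_set_lt (d : measure_display) (T : measurableType d)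
    (R : realType) (f g : T -> R) :
  measurable_fun setT f -> measurable_fun setT g ->
  measurable [set w | f w < g w].
Proof.
move=> mf mg.
rewrite (_ : [set w | f w < g w] = ~` [set w | g w <= f w]).
  by apply: measurableC; exact: measurable_set_le.
by apply/seteqP; split => w /=; rewrite ltNge => /negP.
Qed.

Lemma measure_bigcup_ord_le (d : measure_display) (T : measurableType d)
    (R : realType) (P : probability T R) (n : nat) (F : 'I_n -> set T) :
  (forall i, measurable (F i)) ->
  (P (\bigcup_(i in [set: 'I_n]) F i) <= \sum_(i < n) P (F i))%E.
Proof.
move=> mF.
have [mU PU] : measurable (\big[setU/set0]_(i < n) F i) /\
    (P (\big[setU/set0]_(i < n) F i) <= \sum_(i < n) P (F i))%E.
  (* Measurability is carried along in the induction because subadditivity for two sets asks for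
     it. *)
  apply: (big_ind2 (fun (U : set T) x => measurable U /\ (P U <= x)%E)).
  - by rewrite measure0.
  - move=> U x V y [mU Ux] [mV Vy]; split; first exact: measurableU.
    exact: le_trans (measureU2 P mU mV) (leeD Ux Vy).
  - by move=> i _.
apply: le_trans PU; apply: le_measure; rewrite ?inE//.
  by apply: fin_bigcup_measurable => //; exact: finite_finset.
by move=> w [i _ Fi]; rewrite (bigD1 i)//=; left.
Qed.

Lemma le_probability3 (d : measure_display) (T : measurableType d)
    (R : realType) (P : probability T R) (A B C D : set T) (a b : R) :
  measurable A -> measurable B -> measurable C -> measurable D ->
  A `<=` B `|` C `|` D -> (P B <= a%:E)%E -> (P C <= b%:E)%E -> P D = 0%E ->
  (P A <= (a + b)%:E)%E.
Proof.
move=> mA mB mC mD ABCD Ba Cb D0.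
apply: (@le_trans _ _ (P (B `|` C `|` D))).
  by apply: le_measure; rewrite ?inE//; do 2 apply: measurableU => //.
apply: (@le_trans _ _ (P (B `|` C) + P D)%E).
  by apply: measureU2 => //; exact: measurableU.
rewrite D0 adde0; apply: (@le_trans _ _ (P B + P C)%E); first exact: measureU2.
by rewrite EFinD; exact: leeD.
Qed.

(* Truncating each summand to [0, eps] turns the sum into one whose variance
   is at most eps times its mean, so that Chebyshev's inequality applies. *)
Lemma independent_sum_tail (d : measure_display) (T : measurableType d)
    (R : realType) (P : probability T R) (n : nat) (X : 'I_n -> {RV P >-> R})
    (eps p K : R) :
  0 < eps -> eps <= K / 8 -> independent_RVs P X ->
  (forall i, P [set w | X i w < 0] = 0%E) ->
  (forall i, (P [set w | (eps < X i w)%R] <= p%:E)%E) ->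
  (P [set w | (K <= \sum_(i < n) X i w)%R] <= (2^-1)%:E)%E ->
  (P [set w | (3 * K <= \sum_(i < n) X i w)%R] <= (2 * eps / K + n%:R * p)%:E)%E.
Proof.
move=> e0 eK indep X0 Xp SK.
have K0 : 0 < K by lra.
have mX i : measurable_fun setT (X i) by exact: measurable_funPT.
pose f (x : R) := Num.min (Num.max x 0) eps.
have mf : measurable_fun setT f by apply: measurable_minr => //; exact: measurable_maxr.
have f0 x : 0 <= f x <= eps.
  by rewrite /f le_min ge_min lexx orbT (ltW e0) le_max lexx orbT.
have f_le x : 0 <= x -> f x <= x.
  by move=> x0; rewrite /f ge_min ge_max lexx x0.
have f_id x : 0 <= x -> x <= eps -> f x = x.
  by move=> x0 xe; rewrite /f (max_idPl x0); apply/min_idPl.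
have /choice[Y YE] : forall i, exists Y : {RV P >-> R}, f \o X i = Y.
  by move=> i; apply: measurable_RV; exact: measurableT_comp.
have mY i : measurable_fun setT (Y i) by exact: measurable_funPT.
have [S SE] : exists S : {RV P >-> R}, (fun w => \sum_(i < n) Y i w) = S.
  by apply: measurable_RV; exact: measurable_sum.
have mS : measurable_fun setT S by exact: measurable_funPT.
have mSX : measurable_fun setT (fun w => \sum_(i < n) X i w) by exact: measurable_sum.
have VS : ('V_P[S] <= eps%:E * 'E_P[S])%E.
  apply: (@variance_sum_le _ _ _ _ _ Y) => [i w|i j ij|w].
  - by rewrite -YE /=.
  - by rewrite -!YE; exact: (independent_RVs_pair mf indep ij).
  - by rewrite -SE.
pose m := fine 'E_P[S]%E.
have S0 w : 0 <= S w.
  by rewrite -SE sumr_ge0// => i _; rewrite -YE /=; have /andP[] := f0 (X i w).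
have ES : ('E_P[S] = m%:E)%E.
  rewrite fineK//; apply: expectation_fin_num.
  rewrite Lfun_subset12 ?fin_num_measure//.
  apply: (@bounded_Lfun2 _ _ _ _ _ (\sum_(i < n) eps)) => // w.
  rewrite ger0_norm// -SE; apply: ler_sum => i _.
  by rewrite -YE /=; have /andP[] := f0 (X i w).
have m0 : 0 <= m by rewrite fine_ge0// expectation_ge0.
have cheb (r : R) : 0 < r ->
    (P [set w | (r <= `|S w - m|)%R] <= (eps * m / r ^+ 2)%:E)%E.
  move=> r0; apply: (le_trans (chebyshev _ r0)).
  rewrite mulrC EFinM [(eps * m)%:E]EFinM -ES.
  by apply: lee_wpmul2l VS; rewrite lee_fin invr_ge0 sqr_ge0.
have mN i : measurable [set w | X i w < 0] by exact: measurable_set_lt.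
have mE i : measurable [set w | eps < X i w] by exact: measurable_set_lt.
have mcheb r : measurable [set w | r <= `|S w - m|].
  apply: measurable_set_le => //; apply: measurableT_comp => //.
  exact: measurable_funB.
(* Exceptional events: off the null set [N] truncation can only lower the sum; off both [N] and [E]
   below it changes nothing. *)
pose N := \bigcup_(i in [set: 'I_n]) [set w | X i w < 0].
have mNN : measurable N by apply: fin_bigcup_measurable => //; exact: finite_finset.
have PN : P N = 0%E.
  apply/eqP; rewrite eq_le measure_ge0 andbT.
  by have := measure_bigcup_ord_le P mN; rewrite big1.
pose E := \bigcup_(i in [set: 'I_n]) [set w | eps < X i w].
have mEE : measurable E by apply: fin_bigcup_measurable => //; exact: finite_finset.
have PE : (P E <= (n%:R * p)%:E)%E.
  have -> : (n%:R * p)%:E = (\sum_(i < n) p%:E)%E.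
    by rewrite sumEFin sumr_const card_ord mulr_natl.
  by apply: le_trans (measure_bigcup_ord_le P mE) _; exact: lee_sum.
have X_ge0 w i : ~ N w -> 0 <= X i w.
  by move=> Nw; rewrite leNgt; apply/negP => h; apply: Nw; exists i.
have S_le w : ~ N w -> S w <= \sum_(i < n) X i w.
  move=> Nw; rewrite -SE; apply: ler_sum => i _; rewrite -YE /=.
  exact/f_le/X_ge0.
have S_eq w : ~ N w -> ~ E w -> S w = \sum_(i < n) X i w.
  move=> Nw Ew; rewrite -SE; apply: eq_bigr => i _; rewrite -YE /= f_id//.
    exact: X_ge0.
  by rewrite leNgt; apply/negP => h; apply: Ew; exists i.
have mK (a : R) : measurable [set w | a <= \sum_(i < n) X i w].
  exact: measurable_set_le.
(* If m > 2K, then off [N] either the sum is at least K or S < K < m/2, whence |S - m| >= m/2. The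
   two probabilities are at most 1/2 and 4 eps / m <= 1/4, too little to cover the whole space. *)
have m2K : m <= 2 * K.
  rewrite leNgt; apply/negP => Km.
  have m_gt0 : 0 < m by lra.
  have : (P setT <= (2^-1 + eps * m / (m / 2) ^+ 2)%:E)%E.
    apply: (le_probability3 _ (mK K) (mcheb (m / 2)) mNN _ SK (cheb _ _) PN) => //.
      move=> w _; have [Nw|Nw] := pselect (N w); first by right.
      left; have [KX|XK] := leP K (\sum_(i < n) X i w); first by left.
      right => /=; have := S_le w Nw => SX.
      rewrite distrC ger0_norm; lra.
    by rewrite divr_gt0.
  rewrite probability_setT lee_fin.
  have -> : eps * m / (m / 2) ^+ 2 = 4 * eps / m by field; lra.
  have : 4 * eps / m <= 4^-1 by rewrite ler_pdivrMr//; lra.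
  lra.
have {}cheb : (P [set w | (K <= `|S w - m|)%R] <= (2 * eps / K)%:E)%E.
  apply: (le_trans (cheb _ K0)); rewrite lee_fin.
  have -> : 2 * eps / K = eps * (2 * K) / K ^+ 2 by field; lra.
  by rewrite ler_pM2r ?invr_gt0 ?exprn_gt0// ler_pM2l.
(* Off [N] and [E], [S] is the sum itself, so S - m >= 3K - 2K = K. *)
apply: (le_probability3 (mK (3 * K)) (mcheb K) mEE mNN _ cheb PE PN) => w /= Kw.
have [Nw|Nw] := pselect (N w); first by right.
left; have [Ew|Ew] := pselect (E w); first by right.
by left; have := S_eq w Nw Ew => /= SX; rewrite SX ger0_norm; lra.
Qed.

(** * Infinitely divisible laws with light tails are bounded *)

Lemma iid_RVs_power (d : measure_display) (T : measurableType d) (R : realType)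
    (P : probability T R) (n : nat) (X : 'I_n -> {RV P >-> R}) (i : 'I_n)
    (B : set R) :
  iid_RVs P X -> measurable B ->
  (fine (P (X i @^-1` B)) ^+ n)%:E = P (\bigcap_(j in [set: 'I_n]) (X j @^-1` B)).
Proof.
move=> [indep ident] mB; rewrite (indep (fun=> B))//.
rewrite (eq_bigr (fun=> (fine (P (X i @^-1` B)))%:E)); last first.
  move=> j _; rewrite fineK; first exact: (ident j i).
  by rewrite fin_num_measure//; exact: measurable_funPTI.
by rewrite prodEFin prodr_const card_ord.
Qed.

(* The last hypothesis controls the n-th convolution roots X of H through
   P(X > eps)^n <= P(H > n eps). *)
Lemma infinitely_divisible_light_tail_bounded (d : measure_display)
    (T : measurableType d) (R : realType) (P : probability T R)
    (H : {RV P >-> R}) :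
  infinitely_divisible H -> P [set w | H w < 0] = 0%E ->
  (forall eps eta : R, 0 < eps -> 0 < eta -> exists (n : nat) (p : R),
    [/\ (1 < n)%N, 0 <= p, n%:R * p <= eta &
      (P [set w | (n%:R * eps < H w)%R] <= (p ^+ n)%:E)%E]) ->
  exists x : R, P [set w | x <= H w] = 0%E.
Proof.
move=> idH H0 tail.
have mH : measurable_fun setT H by exact: measurable_funPT.
(* [K] is fixed before the accuracy [e]. With eps = 1 and eta = 1/2, n p <= 1/2 gives p^n <= p <=
   1/2; the level n + 1 passes from the strict inequality to the weak one. *)
have [K [K0 HK]] : exists K : R, 0 < K /\ (P [set w | (K <= H w)%R] <= (2^-1)%:E)%E.
  have [n [p [n1 p0 np pn]]] := tail 1 2^-1 ltr01 ltac:(by rewrite invr_gt0).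
  have n2 : 2 <= n%:R :> R by rewrite ler_nat.
  exists (n%:R + 1); split; first lra.
  apply: (@le_trans _ _ (P [set w | (n%:R * 1 < H w)%R])).
    apply: le_measure; rewrite ?inE; [exact: measurable_set_le|exact: measurable_set_lt|].
    by move=> w /= h; lra.
  apply: (le_trans pn); rewrite lee_fin.
  have p1 : p <= 2^-1 by nra.
  apply: (@le_trans _ _ (p ^+ 1)); last by rewrite expr1.
  by rewrite ler_wiXn2l//; [lra | exact: ltnW].
exists (3 * K); apply/eqP; rewrite eq_le measure_ge0 andbT.
apply/lee_addgt0Pr => e e0; rewrite add0e.
(* K / 8 is the smallness asked for by [independent_sum_tail]; e K / 4 makes its term 2 eps / K at
   most e / 2. The other half of [e] bounds n p. *)
pose eps := Num.min (K / 8) (e * K / 4).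
have eps0 : 0 < eps by rewrite lt_min !divr_gt0// mulr_gt0.
have [n [p [n1 p0 np pn]]] := tail eps (e / 2) eps0 ltac:(by rewrite divr_gt0).
have [d' [T' [P' [X [iid HX]]]]] := idH n n1.
have n0 : (0 < n)%N by exact: ltnW.
have mX i : measurable_fun setT (X i) by exact: measurable_funPT.
have mS : measurable_fun setT (fun w => \sum_(i < n) X i w) by exact: measurable_sum.
have sumX (B : set R) : measurable B ->
    P' [set w | B (\sum_(i < n) X i w)] = P [set w | B (H w)].
  by move=> mB; have := HX B mB.
(* Transfers tail information from [H] to one summand: P(X_i in B)^n is the probability that all
   summands lie in [B], which forces the sum into [C]. *)
have all_sum (i : 'I_n) (B C : set R) : measurable B -> measurable C ->
    (forall x : 'I_n -> R, (forall j, B (x j)) -> C (\sum_(j < n) x j)) ->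
    ((fine (P' (X i @^-1` B)) ^+ n)%:E <= P [set w | C (H w)])%E.
  move=> mB mC BC; rewrite (iid_RVs_power i iid mB) -sumX//.
  apply: le_measure; rewrite ?inE.
  - apply: fin_bigcap_measurable => //.
    by move=> j _; exact: measurable_funPTI.
  - by rewrite -[X in measurable X]setTI; exact: mS.
  - by move=> w /= Bw; apply: BC => j; exact: Bw.
have fineP (B : set R) i : measurable B -> P' (X i @^-1` B) \is a fin_num.
  by move=> mB; rewrite fin_num_measure//; exact: measurable_funPTI.
have fine0 (B : set R) i : 0 <= fine (P' (X i @^-1` B)) by rewrite fine_ge0.
(* Adding strict inequalities stays strict only over a nonempty index set. *)
have has_ord : has xpredT (index_enum 'I_n).
  by apply/hasP; exists (Ordinal n0) => //; rewrite mem_index_enum.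
have X0 i : P' [set w | X i w < 0] = 0%E.
  have mB : measurable [set x : R | x < 0] by exact: measurable_set_lt.
  have := all_sum i _ _ mB mB; rewrite H0 lee_fin => le0.
  have {}le0 : fine (P' (X i @^-1` [set x | x < 0])) ^+ n <= 0.
    apply: le0 => x x0 /=; apply: (@lt_le_trans _ _ (\sum_(j < n) (0 : R))).
      by apply: ltr_sum => // j _; exact: x0.
    by rewrite big1.
  have : fine (P' (X i @^-1` [set x | x < 0])) ^+ n == 0.
    by rewrite eq_le le0 exprn_ge0.
  by rewrite expf_eq0 n0 /= fine_eq0 ?fineP// => /eqP.
have Xp i : (P' [set w | (eps < X i w)%R] <= p%:E)%E.
  have mB a : measurable [set x : R | a < x] by exact: measurable_set_lt.
  have := all_sum i _ _ (mB eps) (mB (n%:R * eps)) => le_p.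
  change (P' (X i @^-1` [set x | (eps < x)%R]) <= p%:E)%E.
  rewrite -(fineK (fineP _ i (mB eps))) lee_fin -(@ler_pXn2r _ n)// ?nnegrE//.
  rewrite -lee_fin; apply: le_trans pn; apply: le_p => x xeps.
  rewrite mulr_natl -[X in _ *+ X](card_ord n) -sumr_const.
  by apply: ltr_sum => // j _; exact: xeps.
have mge a : measurable [set x : R | a <= x] by exact: measurable_set_le.
rewrite -(sumX [set x | 3 * K <= x])//.
have eK : eps <= K / 8 by rewrite /eps ge_min lexx.
have eeK : eps <= e * K / 4 by rewrite /eps ge_min lexx orbT.
apply: (le_trans (independent_sum_tail eps0 eK iid.1 X0 Xp _)).
  by rewrite (sumX [set x | K <= x]).
rewrite lee_fin (_ : e = e / 2 + e / 2); last by field.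
apply: lerD => //; rewrite ler_pdivrMr//; lra.
Qed.

(** * Almost sure comparison and elementary analytic estimates *)

Lemma probability_le_ae (d : measure_display) (T : measurableType d)
    (R : realType) (P : probability T R) (A B : set T) :
  measurable A -> measurable B -> {ae P, forall w, A w -> B w} ->
  (P A <= P B)%E.
Proof.
move=> mA mB [N [mN PN NAB]].
apply: (@le_trans _ _ (P (B `|` N))).
  apply: le_measure; rewrite ?inE//; first exact: measurableU.
  move=> w Aw; have [Bw|Bw] := pselect (B w); first by left.
  by right; apply: NAB => /= /(_ Aw).
apply: (@le_trans _ _ (P B + P N)%E); first exact: measureU2.
by rewrite PN adde0.
Qed.

(** The cubic term of the exponential series beats the square. The number of summands will be 2 m^2,
    while the square root in the Laplace exponent makes the decay linear in [m] in the exponent. *)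
Lemma sqr_expR_small (R : realType) (a b : R) : 0 < a -> 0 < b ->
  exists2 m : nat, (0 < m)%N & m%:R ^+ 2 * expR (- (a * m%:R)) <= b.
Proof.
(* Threshold beyond which b (a m)^3 / 6 >= m^2. *)
move=> a0 b0; pose x := 6 / (a ^+ 3 * b).
exists (Num.truncn x).+1 => //; set m : R := _.+1%:R.
have xm : x < m by exact: truncnS_gt.
have x0 : 0 < x by rewrite divr_gt0// mulr_gt0// exprn_gt0.
have m0 : 0 < m by exact: lt_trans xm.
have am : 0 < a * m by exact: mulr_gt0.
have := @expR_ge1Dxn R (a * m) 2 (ltW am).
rewrite (_ : 3`!%:R = 6 :> R); last by rewrite !factS fact0.
rewrite expRN ler_pdivrMr ?expR_gt0// => h.
apply: (@le_trans _ _ (b * ((a * m) ^+ 3 / 6))); last first.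
  by rewrite ler_pM2l//; lra.
have -> : b * ((a * m) ^+ 3 / 6) = m ^+ 2 * (m / x) by rewrite /x; field; lra.
by rewrite ler_peMr ?sqr_ge0// ler_pdivlMr// mul1r ltW.
Qed.

Section sqrt_bounds.
Variables (R : realType) (m gamma : R).
Hypotheses (m0 : 0 <= m) (gamma0 : 0 <= gamma).

(** This lower bound serves the light tail of the first-passage time, the upper bound after it the
    unboundedness. *)
Lemma sqrtr_sqrD_ge : m <= Num.sqrt (m ^+ 2 + gamma ^+ 2).
Proof.
rewrite -[leLHS](ger0_norm m0) -sqrtr_sqr ler_wsqrtr// lerDl sqr_ge0//.
Qed.

Lemma sqrtr_sqrD_le : Num.sqrt (m ^+ 2 + gamma ^+ 2) <= m + gamma.
Proof.
rewrite -[leRHS]ger0_norm ?addr_ge0// -sqrtr_sqr ler_wsqrtr// sqrrD.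
by rewrite -addrA [X in _ <= _ + X]addrC lerD2l lerDl mulrn_wge0// mulr_ge0.
Qed.

End sqrt_bounds.

(** * The first-passage time of the inverse Gaussian subordinator *)

Section inverse_gaussian.
Context (R : realType) (d : measure_display) (T : measurableType d)
  (P : probability T R).
Variables (delta gamma t : R) (G : R -> {RV P >-> R}) (H : {RV P >-> R}).
Hypotheses (delta0 : 0 < delta) (gamma0 : 0 <= gamma) (t0 : 0 < t).
Hypothesis IG : inverse_gaussian_subordinator delta gamma G.
Hypothesis HP : is_first_passage_RV G t H.

Let mG s : measurable_fun [set: T] (G s).
Proof. exact: measurable_funPT. Qed.

Let mH : measurable_fun [set: T] H.
Proof. exact: measurable_funPT. Qed.

Lemma first_passage_ge0 : P [set w | H w < 0] = 0%E.
Proof.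
apply/eqP; rewrite eq_le measure_ge0 andbT -(measure0 P).
apply: probability_le_ae => //; first exact: measurable_set_lt.
apply: filterS HP => w Hw /=; rewrite -lte_fin Hw ltNge => /negP; apply.
by apply: le_ereal_inf_tmp => _ [s [s0 _] <-]; rewrite lee_fin.
Qed.

(** Chernoff's bound for -G(s) at level -t: its moment generating function at [u] is the Laplace
    transform of G(s). *)
Lemma inverse_gaussian_chernoff (u s : R) : 0 < u -> 0 <= s ->
  (P [set w | (G s w <= t)%R] <=
   (expR (u * t - s * delta * (Num.sqrt (2 * u + gamma ^+ 2) - gamma)))%:E)%E.
Proof.
move=> u0 s0.
have [X XE] : exists X : {RV P >-> R}, (fun w => - G s w) = X.
  by apply: measurable_RV; exact: measurableT_comp (mG s).
have := chernoff X (- t) u0; rewrite /mmt_gen_fun -XE.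
rewrite (_ : expR \o u \o* _ = fun w => expR (- (u * G s w))); last first.
  by apply/funext => w /=; rewrite mulNr mulrC.
rewrite IG.2// -EFinM -expRD mulrN opprK addrC => h; apply: le_trans h.
rewrite le_eqVlt; apply/orP; left; apply/eqP.
by congr (P _); apply/seteqP; split => w /=; rewrite lerN2.
Qed.

(** When the infimum exceeds [s], the time [s] is not in the set over which it is taken, so G(s) <=
    t. *)
Lemma first_passage_tail (u s : R) : 0 < u -> 0 <= s ->
  (P [set w | (s < H w)%R] <=
   (expR (u * t - s * delta * (Num.sqrt (2 * u + gamma ^+ 2) - gamma)))%:E)%E.
Proof.
move=> u0 s0; apply: le_trans (inverse_gaussian_chernoff u0 s0).
apply: probability_le_ae; [exact: measurable_set_lt|exact: measurable_set_le|].
apply: filterS HP => w Hw /=; rewrite -lte_fin Hw leNgt => sH; apply/negP => tG.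
have : (first_passage_time G t w <= s%:E)%E.
  by apply: ereal_inf_lbound; exists s.
by rewrite leNgt sH.
Qed.

Lemma first_passage_unbounded (x : R) : P [set w | x <= H w] <> 0%E.
Proof.
move=> Hx0.
(* A level at least [x] that is also a legitimate time for the Laplace formula. *)
pose s := Num.max x 1.
have s0 : 0 <= s by rewrite le_max ler01 orbT.
have Hs : {ae P, forall w, H w < s}.
  exists [set w | x <= H w]; split => //; first exact: measurable_set_le.
  move=> w /= /negP; rewrite -leNgt; apply: le_trans.
  by rewrite le_max lexx.
have tG : {ae P, forall w, t < G s w}.
  apply: filterS3 HP Hs IG.1.2 => w Hw; rewrite -lte_fin Hw.
  move=> /ereal_inf_lt[_ [r [r0 tr] <-]]; rewrite lte_fin => rs mono.
  exact: lt_le_trans tr (mono _ _ r0 (ltW rs)).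
have laplace u : 0 < u ->
    u * t <= s * delta * (Num.sqrt (2 * u + gamma ^+ 2) - gamma).
  move=> u0; rewrite -lerN2 -ler_expR -lee_fin -IG.2//.
  have ae_le : {ae P, forall w, expR (- (u * G s w)) <= cst (expR (- (u * t))) w}.
    by apply: filterS tG => w tGw /=; rewrite ler_expR lerN2 ler_pM2l// ltW.
  rewrite -(expectation_cst P); apply: expectation_le ae_le => //=.
  apply: measurableT_comp => //; apply: measurableT_comp => //.
  exact: measurable_funM.
(* With u = 2 m^2 the radicand is (2m)^2 + gamma^2, so the bound by [laplace] becomes 2 m^2 t <= 2 m
   s delta, that is m t <= s delta; but m t = s delta + t. *)
pose m := s * delta / t + 1.
have m0 : 0 < m by rewrite ltr_wpDl// divr_ge0// ?mulr_ge0// ltW.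
have := laplace (2 * m ^+ 2) ltac:(by rewrite mulr_gt0// exprn_gt0).
have -> : 2 * (2 * m ^+ 2) = (2 * m) ^+ 2 by ring.
have := sqrtr_sqrD_le (ltac:(lra) : 0 <= 2 * m) gamma0.
set q := Num.sqrt _ => qm.
apply/negP; rewrite -ltNge; apply: (@le_lt_trans _ _ (s * delta * (2 * m))).
  by apply: ler_wpM2l; [rewrite mulr_ge0// ltW|lra].
have -> : 2 * m ^+ 2 * t = (m * t) * (2 * m) by ring.
rewrite ltr_pM2r; last lra.
by rewrite /m mulrDl mul1r divfK ?gt_eqF// ltrDl.
Qed.

(** At time n eps and with u = n, the exponent in [first_passage_tail] is [n] times a single
    quantity, so the bound is an exact n-th power p^n. *)
Lemma first_passage_light_tail (eps eta : R) : 0 < eps -> 0 < eta ->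
  exists (n : nat) (p : R),
    [/\ (1 < n)%N, 0 <= p, n%:R * p <= eta &
      (P [set w | (n%:R * eps < H w)%R] <= (p ^+ n)%:E)%E].
Proof.
move=> eps0 eta0.
(* [c] collects the factors of [p] free of [n]. As q >= 2m, n p <= 2 c m^2 exp(- 2 eps delta m),
   which dictates the arguments given to [sqr_expR_small]. *)
pose c := expR (t + eps * delta * gamma).
have c0 : 0 < c by exact: expR_gt0.
have [m m0 hm] := @sqr_expR_small R (2 * (eps * delta)) (eta / (2 * c))
  ltac:(by rewrite !mulr_gt0) ltac:(by rewrite divr_gt0// mulr_gt0).
(* Chosen so that 2n = (2m)^2 is a perfect square under the root. *)
pose n := (2 * m ^ 2)%N.
have nE : n%:R = 2 * m%:R ^+ 2 :> R by rewrite natrM natrX.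
have n0 : 0 < n%:R :> R by rewrite ltr0n muln_gt0 expn_gt0 m0.
pose q : R := Num.sqrt (2 * n%:R + gamma ^+ 2).
have qm : 2 * m%:R <= q.
  have := @sqrtr_sqrD_ge R (2 * m%:R) gamma ltac:(by rewrite mulr_ge0).
  by rewrite /q nE (_ : (2 * m%:R) ^+ 2 = 2 * (2 * m%:R ^+ 2))//; ring.
exists n, (expR (t - eps * delta * (q - gamma))); split.
- by apply: (@leq_mul 2 1 2 _) => //; rewrite expn_gt0 m0.
- exact: expR_ge0.
- apply: (@le_trans _ _ (n%:R * (c * expR (- (2 * (eps * delta) * m%:R))))).
    rewrite ler_pM2l// -expRD ler_expR.
    have : eps * delta * (2 * m%:R) <= eps * delta * q.
      by rewrite ler_pM2l// mulr_gt0.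
    lra.
  rewrite nE (_ : eta = 2 * c * (eta / (2 * c))); last by field; lra.
  rewrite (_ : 2 * m%:R ^+ 2 * _ =
    2 * c * (m%:R ^+ 2 * expR (- (2 * (eps * delta) * m%:R)))); last by ring.
  by rewrite ler_pM2l// mulr_gt0.
- apply: (le_trans (first_passage_tail n0 _)).
    by rewrite mulr_ge0// ltW.
  rewrite lee_fin -expRM_natl ler_expR -/q mulr_natl; lra.
Qed.

End inverse_gaussian.

Unset Implicit Arguments.
Set Strict Implicit.

Theorem proposition3p3 (R : realType) (d : measure_display)
    (T : measurableType d) (P : probability T R)
    (delta gamma : R) (G H : R -> {RV P >-> R}) :
  0 < delta -> 0 <= gamma ->
  inverse_gaussian_subordinator delta gamma G ->
  (forall t : R, 0 <= t -> is_first_passage_RV G t (H t)) ->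
  forall t : R, 0 < t -> ~ infinitely_divisible (H t).
Proof.
move=> delta0 gamma0 IG HP t t0 idH; have {}HP := HP t (ltW t0).
have [x] := infinitely_divisible_light_tail_bounded idH (first_passage_ge0 HP)
  (first_passage_light_tail delta0 IG HP).
exact: first_passage_unbounded delta0 gamma0 t0 IG HP x.
Qed.
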